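(* Let $K$ be an algebraically closed field (of any characteristic), let $n\ge 1$, and let $X\subset \mathbb G_m^n$ be an algebraic subset of dimension $d$. Then there is a constant $c=c(X)>0$ such that $\#X_T\le c\,T^{d+1}$ for all $T\ge 1$.
   Context: $\mathbb G_m^n=(K\setminus\{0\})^n$ with coordinate-wise multiplication. An algebraic subset of $\mathbb G_m^n$ is the common zero set in $\mathbb G_m^n$ of finitely many Laurent polynomials in $K[X_1^{\pm1},\dots,X_n^{\pm1}]$. $(\mathbb G_m^n)_{\mathrm{tors}}$ is the set of elements of finite order of the group $\mathbb G_m^n$, called torsion points, and $\mathrm{ord}$ denotes the order. For $T\ge1$, $X_T=\{\boldsymbol\zeta\in X\cap(\mathbb G_m^n)_{\mathrm{tors}}:\mathrm{ord}(\boldsymbol\zeta)\le T\}$. *)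

(* Defs.v *)
From HB Require Import structures.
From mathcomp Require Import all_boot all_order all_algebra.
From mathcomp Require Import finmap.
From mathcomp Require Import boolp classical_sets cardinality reals.
Set Implicit Arguments.
Unset Strict Implicit.
Unset Printing Implicit Defensive.
Import Order.TTheory GRing.Theory Num.Theory.
Local Open Scope classical_set_scope.
Local Open Scope ring_scope.

Section GroupOrder.
Variable G : groupType.

Definition is_torsion (x : G) : Prop := exists m, (0 < m)%N && (x ^+ m == 1)%g.

(* The fingroup notation #[x] is only available in finite groups.  Elements of
   infinite order are sent to 0. *)
Definition ord (x : G) : nat :=
  if pselect (is_torsion x) is left tx then ex_minn tx else 0%N.

End GroupOrder.

Section Torus.
Variables (K : fieldType) (n : nat).

Record Gm : Type := MkGm {
  coords :> {ffun 'I_n -> K};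
  coords_neq0 : [forall i, coords i != 0]
}.

HB.instance Definition _ := [isSub for coords].
HB.instance Definition _ := [Choice of Gm by <:].

Implicit Types x y z : Gm.

Lemma Gm_neq0 x i : x i != 0.
Proof. exact: (forallP (coords_neq0 x)). Qed.

Fact Gm_one_subproof : [forall i, [ffun _ : 'I_n => 1 : K] i != 0].
Proof. by apply/forallP => i; rewrite ffunE oner_neq0. Qed.
Definition Gm_one : Gm := MkGm Gm_one_subproof.

Fact Gm_mul_subproof x y : [forall i, [ffun j => x j * y j] i != 0].
Proof. by apply/forallP => i; rewrite ffunE mulf_neq0 ?Gm_neq0. Qed.
Definition Gm_mul x y : Gm := MkGm (Gm_mul_subproof x y).

Fact Gm_inv_subproof x : [forall i, [ffun j => (x j)^-1] i != 0].
Proof. by apply/forallP => i; rewrite ffunE invr_neq0 ?Gm_neq0. Qed.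
Definition Gm_inv x : Gm := MkGm (Gm_inv_subproof x).

Fact Gm_mulA : associative Gm_mul.
Proof. by move=> x y z; apply/val_inj/ffunP => i; rewrite !ffunE mulrA. Qed.
Fact Gm_mul1 : left_id Gm_one Gm_mul.
Proof. by move=> x; apply/val_inj/ffunP => i; rewrite !ffunE mul1r. Qed.
Fact Gm_mulr1 : right_id Gm_one Gm_mul.
Proof. by move=> x; apply/val_inj/ffunP => i; rewrite !ffunE mulr1. Qed.
Fact Gm_mulV : left_inverse Gm_one Gm_inv Gm_mul.
Proof.
by move=> x; apply/val_inj/ffunP => i; rewrite !ffunE mulVf ?Gm_neq0.
Qed.
Fact Gm_mulrV : right_inverse Gm_one Gm_inv Gm_mul.
Proof.
by move=> x; apply/val_inj/ffunP => i; rewrite !ffunE divff ?Gm_neq0.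
Qed.

HB.instance Definition _ :=
  isGroup.Build Gm Gm_mulA Gm_mul1 Gm_mulr1 Gm_mulV Gm_mulrV.

(* A Laurent polynomial is its finitely supported family of coefficients,
   indexed by the exponent vectors in Z^n. *)
Definition laurent : Type := {fsfun {ffun 'I_n -> int} -> K with 0}.

HB.instance Definition _ := Equality.on laurent.

Definition laurent_eval (p : laurent) (x : Gm) : K :=
  \sum_(e <- finsupp p) p e * \prod_(i < n) x i ^ e i.

Definition algebraic (X : set Gm) : Prop :=
  exists ps : seq laurent,
    X = [set x | forall p, p \in ps -> laurent_eval p x = 0].

Definition irreducible (Z : set Gm) : Prop :=
  [/\ algebraic Z, Z !=set0 &
      forall A B, algebraic A -> algebraic B ->
        Z = A `|` B -> Z = A \/ Z = B].

(* Z 0 `<` Z 1 `<` ... `<` Z k, all irreducible closed and contained in X. *)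
Definition has_chain (X : set Gm) (k : nat) : Prop :=
  exists Z : nat -> set Gm,
    (forall i, (i <= k)%N -> irreducible (Z i) /\ Z i `<=` X) /\
    (forall i, (i < k)%N -> Z i `<` Z i.+1).

(* Krull dimension for the Zariski topology: the maximal length of a chain,
   with the convention that the empty set has dimension -1. *)
Definition has_dim (X : set Gm) (d : int) : Prop :=
  (forall k : nat, has_chain X k -> k%:Z <= d) /\
  ((exists2 k : nat, d = k%:Z & has_chain X k) \/ (X = set0 /\ d = -1)).

Definition torsion_le (R : realType) (X : set Gm) (T : R) : set Gm :=
  [set z | [/\ X z, is_torsion z & (ord z)%:R <= T]].

End Torus.

(* Main.v *)
Require Import Defs.
From mathcomp Require Import all_boot all_order all_algebra.
From mathcomp Require Import finmap.
From mathcomp Require Import boolp classical_sets cardinality reals.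
From mathcomp Require Import closed_field.
From mathcomp Require Import -(notations) mpoly.
Import Order.TTheory GRing.Theory Num.Theory.
Local Open Scope classical_set_scope.
Local Open Scope ring_scope.

Set Implicit Arguments.
Unset Strict Implicit.
Unset Printing Implicit Defensive.

(** Torsion points of a given order [m] form a subset of the grid of [m]-th
roots of unity, so it is enough to show that the points [z] of [X] with
[z ^ m = 1] number at most [C * m ^ d] with [C] independent of [m]; summing
over the orders [m <= T] costs one more factor [T].

The bridge between counting and dimension is algebraic independence of
coordinates.  Call a set [I] of coordinates independent on [X] when no
polynomial in these coordinates vanishes on [X] without vanishing everywhere
([indep]), and let [e] be the largest size of an independent set.

Counting ([count_expg_eq1]).  Each set [J] of [e + 1] coordinates carries a
nonzero relation [r J] on [X].  By the footprint bound ([footprint_bound]) a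
finite set of points has at most as many elements as there are monomials
divisible by no leading monomial of a polynomial vanishing on it.  The
relations [z_i ^ m = 1] bound all exponents by [m], and the relation [r J]
forces an exponent with index in [J] to be bounded independently of [m].
Hence at most [e] exponents of such a monomial are unbounded, which leaves
[O(m ^ e)] monomials.

Dimension ([indep_has_chain]).  A set of [e] independent coordinates yields a
chain of irreducible closed subsets of length [e], whence [e <= d].  A closed
subset minimal among those on which [I] is independent exists because closed
sets satisfy the descending chain condition ([algebraic_dcc]), and it is
irreducible because nonzero polynomials have nonzero product.  Cutting it by a
suitable hyperplane [x_i = a] with [i] in [I] keeps the other coordinates
independent ([indep_slice]), and the induction continues inside the slice.
The hyperplane exists because the projection of a closed set to independent
coordinates contains a nonempty open set ([dense_projection]); this is where
algebraic closedness enters, through quantifier elimination. *)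

(** * Polynomials at generic points *)

Section GenericPoints.
Variables (K : closedFieldType) (n : nat).
Implicit Types (p q g : mpoly n K) (u v w : 'I_n -> K) (I : {set 'I_n}).

Lemma horner_mmap (l : 'I_n -> {poly K}) p s :
  (mmap (@polyC K) l p).[s] = meval (fun i => (l i).[s]) p.
Proof.
rewrite /mmap mevalE horner_sum; apply: eq_bigr => m _.
rewrite hornerM hornerC /mmap1 horner_prod; congr (_ * _).
by apply: eq_bigr => i _; rewrite horner_exp.
Qed.

(** Restricted to the line through [u] and [v], both polynomials become nonzero
univariate polynomials, whose product has a nonroot since an algebraically
closed field is infinite.  Moving along a line keeps the coordinates on which
[u] and [v] agree; this is what confines [w] to a coordinate subspace. *)
Lemma meval_domain p q u v : meval u p != 0 -> meval v q != 0 ->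
  exists w, [/\ meval w p != 0, meval w q != 0 &
                forall i, u i = v i -> w i = u i].
Proof.
move=> pu qv.
pose l i := (u i)%:P + 'X * (v i - u i)%:P.
have l0 r : meval u r = (mmap (@polyC K) l r).[0].
  rewrite horner_mmap; apply: meval_eq => i.
  by rewrite /l !hornerE ?mul0r ?addr0.
have l1 r : meval v r = (mmap (@polyC K) l r).[1].
  rewrite horner_mmap; apply: meval_eq => i.
  by rewrite /l hornerD hornerM hornerX !hornerC mul1r addrC subrK.
have nz : mmap (@polyC K) l p * mmap (@polyC K) l q != 0.
  rewrite mulf_neq0 //.
    by apply: contraNneq pu => E; rewrite l0 E horner0.
  by apply: contraNneq qv => E; rewrite l1 E horner0.
have /closed_nonrootP[s] := nz.
rewrite rootE hornerM mulf_eq0 negb_or !horner_mmap => /andP[ps qs].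
exists (fun i => (l i).[s]); split=> // i uv.
by rewrite /l uv subrr !hornerE ?mulr0 ?addr0.
Qed.

(** A polynomial in the coordinates [I] is encoded as [v |-> p (mask I v)] for
an arbitrary polynomial [p]; freezing the other coordinates at 1 keeps points of
the torus inside it. *)
Definition mask I v : 'I_n -> K := fun i => if i \in I then v i else 1.

Lemma mask_domain I p q u v :
    meval (mask I u) p != 0 -> meval (mask I v) q != 0 ->
  exists w, meval (mask I w) p != 0 /\ meval (mask I w) q != 0.
Proof.
move=> pu qv; have [w [pw qw uw]] := meval_domain pu qv.
exists w; suff E : mask I w =1 w by rewrite !(meval_eq _ E).
by move=> i; rewrite /mask; case: ifP => // iI; rewrite uw /mask iI.
Qed.

(** The valuation under which the [i]-th formal variable takes the value
[v i]. *)
Definition env v : seq K := [seq v i | i <- enum 'I_n].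

Lemma nth_env v (i : 'I_n) : (env v)`_i = v i.
Proof. by rewrite (nth_map i) ?size_enum_ord ?nth_ord_enum. Qed.

Lemma nth_env_default v j : (n <= j)%N -> (env v)`_j = 0.
Proof. by move=> nj; rewrite nth_default // size_map size_enum_ord. Qed.

Fixpoint poly_of_term (t : GRing.term K) : mpoly n K :=
  match t with
  | GRing.Var j => if insub j is Some i then mpolyX K (mnm1 i) else 0
  | GRing.Const c => mpolyC n c
  | GRing.NatConst k => k%:R
  | GRing.Add a b => poly_of_term a + poly_of_term b
  | GRing.Opp a => - poly_of_term a
  | GRing.NatMul a k => poly_of_term a *+ k
  | GRing.Mul a b => poly_of_term a * poly_of_term b
  | GRing.Inv a => 0
  | GRing.Exp a k => poly_of_term a ^+ k
  end.

Lemma meval_poly_of_term v t : GRing.rterm t ->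
  meval v (poly_of_term t) = GRing.eval (env v) t.
Proof.
elim: t => //=.
- move=> j _; case: insubP => [i _ <-|]; first by rewrite mevalXU nth_env.
  by rewrite -leqNgt meval0 => nj; rewrite nth_env_default.
- by move=> c _; rewrite mevalC.
- by move=> k _; rewrite rmorph_nat.
- by move=> a IHa b IHb /andP[ra rb]; rewrite mevalD IHa // IHb.
- by move=> a IHa ra; rewrite mevalN IHa.
- by move=> a IHa k ra; rewrite mevalMn IHa.
- by move=> a IHa b IHb /andP[ra rb]; rewrite mevalM IHa // IHb.
- by move=> a IHa k ra; rewrite rmorphXn /= IHa.
Qed.

Lemma term_of_poly p : exists t, GRing.rterm t /\
  forall v, GRing.eval (env v) t = meval v p.
Proof.
pose P p := exists t, GRing.rterm t /\
  forall v, GRing.eval (env v) t = meval v p.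
have Padd p1 p2 : P p1 -> P p2 -> P (p1 + p2).
  move=> [t [rt et]] [t' [rt' et']]; exists (GRing.Add t t').
  by rewrite /= rt; split=> // v; rewrite et et' mevalD.
have Pmul p1 p2 : P p1 -> P p2 -> P (p1 * p2).
  move=> [t [rt et]] [t' [rt' et']]; exists (GRing.Mul t t').
  by rewrite /= rt; split=> // v; rewrite et et' mevalM.
have PC c : P (mpolyC n c).
  by exists (GRing.Const c); split=> // v; rewrite mevalC.
rewrite -/(P p) (mpolyE p); apply: (big_ind P) => //.
  by rewrite -mpolyC0.
move=> m _; rewrite -mul_mpolyC; apply: (Pmul _ _ (PC _)).
rewrite mpolyXE_id; apply: (big_ind P); [exact: PC 1|exact: Pmul|].
move=> i _; exists (GRing.Exp (GRing.Var K i) (m i)); split=> // v.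
by rewrite rmorphXn /= nth_env mevalXU.
Qed.

(** The Boolean [B] takes a single value on a nonempty Zariski open set of the
coordinate subspace [I]. *)
Definition generically_constant I (B : ('I_n -> K) -> bool) :=
  exists g b, (exists v, meval (mask I v) g != 0) /\
    forall v, meval (mask I v) g != 0 -> B (mask I v) = b.

Lemma generically_constant_op (op : bool -> bool -> bool) I B1 B2 :
  generically_constant I B1 -> generically_constant I B2 ->
  generically_constant I (fun v => op (B1 v) (B2 v)).
Proof.
move=> [g1 [b1 [[v1 n1] h1]]] [g2 [b2 [[v2 n2] h2]]].
have [w [w1 w2]] := mask_domain n1 n2.
exists (g1 * g2), (op b1 b2); split; first by exists w; rewrite mevalM mulf_neq0.
by move=> v; rewrite mevalM mulf_eq0 negb_or => /andP[a1 a2]; rewrite h1 // h2.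
Qed.

(** An equation holds either everywhere or only off the nonempty open set where
its two sides differ, and nonempty open sets meet. *)
Lemma qf_generically_constant I f : GRing.qf_form f -> GRing.rformula f ->
  generically_constant I (fun v => GRing.qf_eval (env v) f).
Proof.
have one : exists v, meval (mask I v) (1 : mpoly n K) != 0.
  by exists (fun=> 1); rewrite meval1 oner_neq0.
elim: f => [b|t1 t2|t|f1 IH1 f2 IH2|f1 IH1 f2 IH2|f1 IH1 f2 IH2|f1 IH1|j f1 IH1
  |j f1 IH1] //=.
- by move=> _ _; exists 1, b.
- move=> _ /andP[r1 r2].
  have E v : (GRing.eval (env v) t1 == GRing.eval (env v) t2) =
    (meval v (poly_of_term t1 - poly_of_term t2) == 0).
    by rewrite mevalB !meval_poly_of_term // subr_eq0.
  have [[v nv]|/forallNP all0] := pselect (exists v,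
      meval (mask I v) (poly_of_term t1 - poly_of_term t2) != 0).
    exists (poly_of_term t1 - poly_of_term t2), false; split; first by exists v.
    by move=> w /negbTE nw; rewrite /= E nw.
  exists 1, true; split=> // w _; rewrite /= E.
  by apply/negPn/negP; exact: all0.
- move=> /andP[q1 q2] /andP[r1 r2].
  exact: (generically_constant_op andb (IH1 q1 r1) (IH2 q2 r2)).
- move=> /andP[q1 q2] /andP[r1 r2].
  exact: (generically_constant_op orb (IH1 q1 r1) (IH2 q2 r2)).
- move=> /andP[q1 q2] /andP[r1 r2].
  exact: (generically_constant_op implb (IH1 q1 r1) (IH2 q2 r2)).
- move=> q1 r1; have [g [b [ng h]]] := IH1 q1 r1.
  by exists g, (~~ b); split=> // v nv; rewrite /= h.
Qed.

End GenericPoints.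

(** * Independent coordinates on an algebraic set *)

Section AlgebraicSets.
Variables (K : closedFieldType) (n : nat).
Implicit Types (p q g : mpoly n K) (u v w : 'I_n -> K) (I J : {set 'I_n}).
Implicit Types (Z X : set (Gm K n)) (z : Gm K n).

(** Multiplying by a large power of [x_1 ... x_n], which vanishes nowhere on
the torus, makes all exponents nonnegative. *)
Lemma clear_denominators (q : laurent K n) : exists p : mpoly n K,
  forall z : Gm K n, meval z p = 0 <-> laurent_eval q z = 0.
Proof.
pose N := (\max_(e <- finsupp q) \max_(i < n) absz (e i))%N.
pose sh (e : {ffun 'I_n -> int}) := Multinom [tuple absz (e i + N%:Z) | i < n].
exists (\sum_(e <- finsupp q) q e *: mpolyX K (sh e)) => z.
suff -> : meval z (\sum_(e <- finsupp q) q e *: mpolyX K (sh e)) =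
    (\prod_(i < n) z i ^+ N) * laurent_eval q z.
  split=> [/eqP|->]; last by rewrite mulr0.
  rewrite mulf_eq0 => /orP[/prodf_eq0[i _]|/eqP//].
  by rewrite expf_eq0 (negbTE (Gm_neq0 z i)) andbF.
rewrite raddf_sum mulr_sumr; apply: eq_big_seq => e eq /=.
rewrite mevalZ mevalX mulrCA -big_split /=; congr (_ * _).
apply: eq_bigr => i _; rewrite mnmE !exprnP -expfzDr ?Gm_neq0 //.
congr (_ ^ _); rewrite addrC; apply: gez0_abs.
have leN : (absz (e i) <= N)%N.
  apply: leq_trans (leq_bigmax_seq _ eq isT).
  exact: (leq_bigmax_cond (F := fun i => absz (e i))).
have : - (e i) <= N%:Z.
  by apply: le_trans (ler_norm _) _; rewrite normrN -abszE lez_nat.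
by rewrite lerNl -subr_ge0 opprK addrC.
Qed.

Lemma algebraic_polys Z : algebraic Z -> exists ps : seq (mpoly n K),
  forall z, Z z <-> (forall p, p \in ps -> meval z p = 0).
Proof.
move=> [qs ->]; have [f fP] := choice clear_denominators.
exists (map f qs) => z; split=> [h p /mapP[q /h hq ->]|h q qin /=].
  exact/fP.
by apply/fP/h/map_f.
Qed.

(** The coordinates in [I] are algebraically independent on [Z], or
equivalently the projection of [Z] to the coordinates [I] is Zariski dense. *)
Definition indep I Z := forall p,
  (forall z, Z z -> meval (mask I z) p = 0) ->
  forall v, meval (mask I v) p = 0.

Lemma holds_foldr_and (T : eqType) (F : T -> GRing.formula K) (s : seq T) e :
  GRing.holds e (foldr (fun x => GRing.And (F x)) (GRing.Bool true) s) <->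
  (forall x, x \in s -> GRing.holds e (F x)).
Proof.
elim: s => [|x s IH] /=; first by [].
split=> [[hx /IH hs] y|h].
  by rewrite inE => /orP[/eqP->|/hs].
split; first by apply: h; rewrite mem_head.
by apply/IH => y ys; apply: h; rewrite inE ys orbT.
Qed.

(** A dense projection contains a nonempty open set.  The projection is defined
by an existential formula; eliminating the quantifiers gives a quantifier-free
formula, whose truth value is constant on some nonempty open set [g != 0].
Were it false there, the projection would lie in [g = 0], against density. *)
Lemma dense_projection I Z : algebraic Z -> indep I Z ->
  exists g, (exists v, meval (mask I v) g != 0) /\
    forall v, meval (mask I v) g != 0 ->
      exists z, Z z /\ forall i, i \in I -> z i = v i.
Proof.
move=> /algebraic_polys[ps psP] indZ.
have [t tP] := choice (@term_of_poly K n).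
pose f1 := foldr (fun p => GRing.And (GRing.Equal (t p) (GRing.Const 0)))
  (GRing.Bool true) ps.
pose f2 := foldr (fun i : 'I_n => GRing.And
    (GRing.Not (GRing.Equal (GRing.Var K i) (GRing.Const 0))))
  (GRing.Bool true) (enum 'I_n).
pose js := [seq val j | j in ~: I].
pose f := foldr (@GRing.Exists K) (GRing.And f1 f2) js.
have rf : GRing.rformula f.
  have r1 : GRing.rformula f1.
    by rewrite /f1; elim: (ps) => //= p s ->; rewrite (tP p).1.
  have r2 : GRing.rformula f2 by rewrite /f2; elim: (enum _).
  by rewrite /f; elim: (js) => //=; rewrite r1 r2.
have wfp := @ClosedFieldQE.wf_ex_elim K.
have okp := @ClosedFieldQE.holds_ex_elim K (@solve_monicpoly K).
set qf := GRing.quantifier_elim (@ClosedFieldQE.ex_elim K) f.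
have /andP[qf_qf qf_r] : GRing.qf_form qf && GRing.rformula qf.
  exact: GRing.quantifier_elim_wf.
have qfP e : reflect (GRing.holds e f) (GRing.qf_eval e qf).
  exact: GRing.quantifier_elim_rformP.
(* [f] says that [v] extends, off [I], to a point of [Z] *)
have sol v : GRing.holds (env (mask I v)) f <->
    exists z, Z z /\ forall i, i \in I -> z i = v i.
  rewrite /f; split=> [/GRing.foldExistsP[e same /= [h1 h2]]|[z [Zz zv]]].
    have ne0 : [forall i : 'I_n, [ffun i : 'I_n => e`_i] i != 0].
      apply/forallP => i; rewrite ffunE; apply/eqP.
      by move/holds_foldr_and: h2; apply; rewrite mem_enum.
    exists (MkGm ne0); split.
      apply/psP => p pin; rewrite -(tP p).2.
      rewrite -[RHS](proj1 (holds_foldr_and _ _ _) h1 p pin).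
      apply: GRing.eq_eval => j; case: (ltnP j n) => jn.
        by rewrite -[j]/(val (Ordinal jn)) nth_env ffunE.
      rewrite -same ?nth_env_default //.
      rewrite !inE; apply/negP => /mapP[i _ ij].
      by move: jn; rewrite ij leqNgt ltn_ord.
    move=> i iI /=; rewrite ffunE -same ?nth_env ?/mask ?iI //.
    rewrite !inE; apply/negP => /mapP[j + /val_inj ij].
    by rewrite mem_enum -ij inE iI.
  apply/GRing.foldExistsP; exists (env z).
    move=> j; rewrite !inE => jn; case: (ltnP j n) => jn'.
      rewrite -[j]/(val (Ordinal jn')) !nth_env /mask.
      case: ifP => [/zv->//|jI].
      case/negP: jn; apply/mapP; exists (Ordinal jn') => //.
      by rewrite mem_enum inE jI.
    by rewrite !nth_env_default.
  split; apply/holds_foldr_and; [move=> p pin /=|move=> i _ /=].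
    by rewrite (tP p).2; apply: (proj1 (psP z)).
  by rewrite nth_env; apply/eqP/Gm_neq0.
have [g [b [ng gP]]] := qf_generically_constant I qf_qf qf_r.
exists g; split=> // v gv; apply/sol/qfP; rewrite gP //.
case: b gP => // gP; case: ng => w /eqP[]; apply: indZ => z Zz.
apply/eqP/negPn/negP => /gP.
by suff /qfP -> : GRing.holds (env (mask I z)) f by []; apply/sol; exists z.
Qed.

Definition mask_mnm I (m : multinom n) : multinom n :=
  Multinom [tuple if i \in I then m i else 0%N | i < n].

Definition mask_poly I p : mpoly n K :=
  \sum_(m <- msupp p) mcoeff m p *: mpolyX K (mask_mnm I m).

Lemma meval_mask_poly I p v : meval v (mask_poly I p) = meval (mask I v) p.
Proof.
rewrite [RHS]mevalE /mask_poly raddf_sum; apply: eq_bigr => m _.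
rewrite /= mevalZ mevalX; congr (_ * _); apply: eq_bigr => i _.
by rewrite mnmE /mask; case: ifP; rewrite ?expr0 ?expr1n.
Qed.

Lemma mlead_mask_poly I p i : i \notin I -> mlead (mask_poly I p) i = 0%N.
Proof.
move=> iI; have [->|r0] := eqVneq (mask_poly I p) 0; first by rewrite mlead0 mnm0E.
apply/eqP/negPn/negP => li; case/negP: r0.
rewrite -mleadc_eq0 {2}/mask_poly raddf_sum big1 //= => m _.
rewrite mcoeffZ mcoeffX; case: eqP; last by rewrite mulr0.
by move=> E; rewrite -E mnmE (negbTE iI) in li.
Qed.

Definition slice Z (i : 'I_n) (a : K) : set (Gm K n) := [set z | Z z /\ z i = a].

Lemma algebraic_slice Z i a : a != 0 -> algebraic Z -> algebraic (slice Z i a).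
Proof.
move=> a0 [ps ->].
pose e1 : {ffun 'I_n -> int} := [ffun j => (j == i)%:Z].
pose e0 : {ffun 'I_n -> int} := [ffun j => 0].
have e10 : e1 != e0.
  by apply/eqP => /ffunP/(_ i); rewrite !ffunE eqxx.
pose q : laurent K n :=
  [fsfun e in [fset e1; e0]%fset => if e == e1 then 1 else - a].
have sq : finsupp q = [fset e1; e0]%fset.
  apply/fsetP => e; rewrite mem_finsupp fsfunE.
  case: ifP => _; last by rewrite eqxx.
  by case: ifP; rewrite ?oner_eq0 ?oppr_eq0.
exists (q :: ps); apply/seteqP; split=> z /=.
  move=> [Zz zi] p; rewrite inE => /orP[/eqP->|/Zz//].
  rewrite /laurent_eval sq big_fsetU1 ?inE ?(eq_sym e1) //=; last first.
    by rewrite eq_sym.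
  rewrite big_seq_fset1 !fsfunE !inE !eqxx /= orbT.
  rewrite eq_sym (negbTE e10) mul1r.
  rewrite (bigD1 i) //= big1 ?mulr1; last first.
    by move=> j /negbTE ji; rewrite ffunE ji expr0z.
  rewrite big1 ?mulr1; last by move=> j _; rewrite ffunE expr0z.
  by rewrite ffunE eqxx expr1z zi subrr.
move=> h; split; first by move=> p pin; apply: h; rewrite inE pin orbT.
have := h q (mem_head _ _).
rewrite /laurent_eval sq big_fsetU1 ?inE //=.
rewrite big_seq_fset1 !fsfunE !inE !eqxx /= orbT.
rewrite eq_sym (negbTE e10) mul1r.
rewrite (bigD1 i) //= big1 ?mulr1; last first.
  by move=> j /negbTE ji; rewrite ffunE ji expr0z.
rewrite big1 ?mulr1; last by move=> j _; rewrite ffunE expr0z.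
by rewrite ffunE eqxx expr1z => /eqP; rewrite subr_eq0 => /eqP.
Qed.

(** The projection of [Z] contains [g != 0] for some [g]; take for [a] the
[i]-th coordinate of a point where [g] is nonzero.  A relation [p] among the
other coordinates on the slice then vanishes wherever [g] does not on the
hyperplane [x_i = a], hence vanishes identically. *)
Lemma indep_slice I Z i : algebraic Z -> indep I Z -> i \in I ->
  exists a, a != 0 /\ indep (I :\ i) (slice Z i a).
Proof.
move=> algZ indZ iI; have [g [[v gv] gP]] := dense_projection algZ indZ.
(* multiplying [g] by [x_i] forces a nonzero [i]-th coordinate *)
have Xi : meval (mask I (fun=> 1)) (mpolyX K (mnm1 i)) != 0.
  by rewrite mevalXU /mask iI oner_neq0.
have [w [gw wi]] := mask_domain gv Xi.
move: wi; rewrite mevalXU /mask iI => wi.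
exists (w i); split=> // p pP u.
apply/eqP/negPn/negP => pu.
pose u1 j := if j == i then w i else mask I u j.
have pu1 : meval u1 (mask_poly (I :\ i) p) != 0.
  rewrite meval_mask_poly; suff E : mask (I :\ i) u1 =1 mask (I :\ i) u.
    by rewrite (meval_eq _ E).
  move=> j; rewrite /mask /u1 /mask !inE.
  by case: eqVneq => //= _; case: (j \in I).
have [x [px gx xE]] := meval_domain pu1 gw.
have xi : x i = w i by rewrite xE /u1 eqxx // /mask iI.
have x1 j : j \notin I -> x j = 1.
  move=> jI; have ji : j != i by apply: contraNneq jI => ->.
  by rewrite xE /u1 /mask (negbTE ji) (negbTE jI).
have mx : mask I x =1 x by move=> j; rewrite /mask; case: ifPn => // /x1.
have [z [Zz zx]] : exists z, Z z /\ forall j, j \in I -> z j = x j.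
  by apply: gP; rewrite (meval_eq _ mx).
case/negP: px; rewrite meval_mask_poly.
suff E : mask (I :\ i) x =1 mask (I :\ i) z.
  by rewrite (meval_eq _ E) pP //; split; rewrite // zx.
by move=> j; rewrite /mask !inE; case: ifP => // /andP[_ jI]; rewrite zx.
Qed.

End AlgebraicSets.

(** * Noetherianity and chains of irreducible sets *)

(** Iterating the choice of an index that minimizes [b] on a tail. *)
Lemma nondecreasing_subseq (b : nat -> nat) :
  exists f : nat -> nat, (forall i j, (i < j)%N -> (f i < f j)%N) /\
    forall i j, (i <= j)%N -> (b (f i) <= b (f j))%N.
Proof.
have tail_min N : exists i, (N <= i)%N /\ forall j, (N <= j)%N -> (b i <= b j)%N.
  have ex : exists k, `[< exists2 i, (N <= i)%N & b i = k >].
    by exists (b N); apply/asboolP; exists N.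
  case: (ex_minnP ex) => k /asboolP[i Ni <-] km.
  by exists i; split=> // j Nj; apply: km; apply/asboolP; exists j.
have [g gP] := choice tail_min.
pose f := fix f k := if k is k'.+1 then g (f k').+1 else g 0%N.
have fS k : (f k < f k.+1)%N by exact: (gP (f k).+1).1.
have fM : {homo f : i j / (i < j)%N}.
  by apply: homo_ltn => // ? ? ?; exact: ltn_trans.
have fle i j : (i <= j)%N -> (f i <= f j)%N.
  by rewrite leq_eqVlt => /orP[/eqP->//|/fM /ltnW].
exists f; split=> // i j ij.
case: i ij => [|i] ij /=; first exact: (gP 0%N).2.
by apply: (gP (f i).+1).2; exact: fM.
Qed.

(** Dickson's lemma: after passing to a subsequence for each coordinate in
turn, all exponents are nondecreasing. *)
Lemma dickson n (a : nat -> multinom n) :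
  exists i j, (i < j)%N /\ lem (a i) (a j).
Proof.
suff [f [fM fle]] : exists f : nat -> nat,
    (forall i j, (i < j)%N -> (f i < f j)%N) /\
    forall k, k \in enum 'I_n ->
      forall i j, (i <= j)%N -> (a (f i) k <= a (f j) k)%N.
  exists (f 0%N), (f 1%N); split; first exact: fM.
  by apply/mnm_lepP => k; apply: fle; rewrite // mem_enum.
elim: (enum 'I_n) => [|k s [f [fM fle]]]; first by exists id.
have [g [gM gle]] := nondecreasing_subseq (fun i => a (f i) k).
exists (f \o g); split=> [i j ij|l]; first by apply/fM/gM.
rewrite inE => /orP[/eqP->|ls] i j ij; first exact: gle.
apply: fle => //; move: ij; rewrite leq_eqVlt => /orP[/eqP->//|/gM].
exact: ltnW.
Qed.

Section Noetherian.
Variables (K : closedFieldType) (n : nat).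
Implicit Types (p q g : mpoly n K) (u v w : 'I_n -> K) (I J : {set 'I_n}).
Implicit Types (Z X : set (Gm K n)) (z : Gm K n).

Lemma min_mlead (P : mpoly n K -> Prop) : (exists p, P p) ->
  exists p, P p /\ forall q, P q -> ~ (mlead q < mlead p)%O.
Proof.
move=> [p0 Pp0]; apply: contrapT => /forallNP none.
have : forall p, ~ P p; last by move/(_ p0).
apply: mleadrect => p IH Pp; apply: (none p); split=> // q Pq qp.
exact: IH Pq.
Qed.

(** One step of multivariate division. *)
Lemma mlead_cancel p r : p != 0 -> r != 0 -> lem (mlead r) (mlead p) ->
  exists s c, let q := p - c *: (mpolyX K s * r) in
    q = 0 \/ (mlead q < mlead p)%O.
Proof.
move=> p0 r0 rp; pose s := mnm_sub (mlead p) (mlead r).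
have X0 : mpolyX K s != 0 by rewrite -mleadc_eq0 mleadXm mcoeffX eqxx oner_eq0.
have Xr0 : mpolyX K s * r != 0 by rewrite mulf_neq0.
have lead : mlead (mpolyX K s * r) = mlead p by rewrite mleadM // mleadXm submK.
have c0 : mleadc (mpolyX K s * r) != 0 by rewrite mleadc_eq0.
exists s, (mleadc p / mleadc (mpolyX K s * r)) => q.
have [->|q0] := eqVneq q 0; [by left | right].
have qm : mcoeff (mlead p) q = 0.
  by rewrite /q mcoeffB mcoeffZ -{3}lead divfK // subrr.
rewrite lt_neqAle; apply/andP; split.
  by apply: contraNneq q0 => E; rewrite -mleadc_eq0 E qm.
apply: le_trans (mleadB_le _ _) _.
rewrite leUx lexx /=; apply: le_trans (mleadZ_le _ _) _.
by rewrite lead.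
Qed.

(** In a strictly decreasing sequence, choose [f k] vanishing on [Z k.+1] but
not on [Z k], with leading monomial as small as possible.  Dickson's lemma
gives [i < j] such that the leading monomial of [f i] divides that of [f j].
As [f i] vanishes on [Z j], cancelling leading terms does not change [f j] on
[Z j], and contradicts the minimality of [f j]. *)
Lemma algebraic_dcc (Z : nat -> set (Gm K n)) :
  (forall k, algebraic (Z k)) -> (forall k, Z k.+1 `<=` Z k) ->
  exists k, Z k.+1 = Z k.
Proof.
move=> algZ dec; apply: contrapT => /forallNP strict.
have Zle i j : (i <= j)%N -> Z j `<=` Z i.
  elim: j => [|j IH]; first by rewrite leqn0 => /eqP->.
  rewrite leq_eqVlt => /orP[/eqP->//|/IH ji].
  exact: subset_trans (dec _) ji.
pose sep k p := (forall z, Z k.+1 z -> meval z p = 0) /\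
  exists z, Z k z /\ meval z p != 0.
have ex k : exists p, sep k p /\ forall q, sep k q -> ~ (mlead q < mlead p)%O.
  apply: min_mlead; apply: contrapT => /forallNP none; apply: (strict k).
  apply/seteqP; split=> // z Zz.
  have [ps psP] := algebraic_polys (algZ k.+1).
  apply/psP => p pin; apply/eqP/negPn/negP => pz; apply: (none p); split.
    by move=> y /psP; exact.
  by exists z.
have [f fP] := choice ex.
have f0 k : f k != 0.
  have [[_ [z [_ +]]] _] := fP k.
  by apply: contraNneq => ->; rewrite meval0.
have [i [j [ij le_ij]]] := dickson (fun k => mlead (f k)).
have [s [c /= q_small]] := mlead_cancel (f0 j) (f0 i) le_ij.
have [[fi0 _] _] := fP i.
have [[fj0 [z [Zz fjz]]] fjmin] := fP j.
set q := (f j - _) in q_small.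
have qE y : Z j y -> meval y q = meval y (f j).
  move=> Zy; rewrite /q mevalB mevalZ mevalM fi0 ?mulr0 ?subr0 //.
  exact: Zle Zy.
have sepq : sep j q.
  split; last by exists z; rewrite qE.
  by move=> y Zy; rewrite qE ?fj0 //; exact: dec.
case: q_small => [q0|]; last exact: fjmin.
by case: sepq => _ [y [_]]; rewrite q0 meval0 eqxx.
Qed.

Lemma minimal_algebraic (P : set (Gm K n) -> Prop) X : algebraic X -> P X ->
  exists Z, [/\ algebraic Z, Z `<=` X, P Z &
    forall Z', algebraic Z' -> Z' `<=` Z -> P Z' -> Z' = Z].
Proof.
move=> algX PX; apply: contrapT => /forallNP none.
pose T := {Z : set (Gm K n) | [/\ algebraic Z, Z `<=` X & P Z]}.
have step (Z : T) : {Z' : T | sval Z' `<=` sval Z /\ sval Z' <> sval Z}.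
  case: Z => Z [algZ ZX PZ] /=; apply: cid; apply: contrapT => /forallNP min.
  apply: (none Z); split=> // Z' algZ' Z'Z PZ'; apply: contrapT => neq.
  have h : [/\ algebraic Z', Z' `<=` X & P Z'].
    by split=> //; exact: subset_trans ZX.
  exact: (min (exist _ Z' h)).
have h : [/\ algebraic X, X `<=` X & P X] by split.
have [f [_ fP]] := dependent_choice step (exist _ X h).
have [|k] := @algebraic_dcc (fun k => sval (f k)) _ (fun k => (fP k).1).
  by move=> k; case: (svalP (f k)).
exact: (fP k).2.
Qed.

(** If [Z] is the union of two smaller closed sets, each of them satisfies a
nontrivial relation by minimality, and the product of the two relations holds
on [Z]. *)
Lemma minimal_indep_irreducible I Z : algebraic Z -> indep I Z ->
  (forall Z', algebraic Z' -> Z' `<=` Z -> indep I Z' -> Z' = Z) ->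
  irreducible Z.
Proof.
move=> algZ indZ minZ; split=> //.
  apply/set0P/eqP => Z0; have := indZ 1 _ (fun=> 1).
  rewrite meval1 => h; suff /eqP : 1 = 0 :> K by rewrite oner_eq0.
  by apply: h => z; rewrite Z0.
move=> A B algA algB ZAB; apply: contrapT => /not_orP[ZA ZB].
have dep C : algebraic C -> C `<=` Z -> Z <> C ->
    exists p v, (forall z, C z -> meval (mask I z) p = 0) /\
      meval (mask I v) p != 0.
  move=> algC CZ ZC; apply: contrapT => /forallNP none.
  apply: ZC; symmetry; apply: minZ => // p pC v; apply/eqP/negPn/negP => pv.
  by apply: (none p); exists v.
have [|p [v [pA pv]]] := dep A algA _ ZA; first by rewrite ZAB; left.
have [|q [w [qB qw]]] := dep B algB _ ZB; first by rewrite ZAB; right.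
have [x [px qx]] := mask_domain pv qw.
have /eqP : meval (mask I x) (p * q) = 0.
  apply: indZ => z; rewrite ZAB mevalM.
  by move=> [/pA ->|/qB ->]; rewrite ?mul0r ?mulr0.
by rewrite mevalM mulf_eq0 (negbTE px) (negbTE qx).
Qed.

(** A minimal closed [Z] with [I] independent is the top of the chain; the
rest is found in a slice of [Z], which is a proper subset because [x_i] is not
constant on [Z]. *)
Lemma indep_has_chain I X : algebraic X -> indep I X -> has_chain X #|I|.
Proof.
move: {2}#|I| (erefl #|I|) => k; elim: k I X => [|k IH] I X Ik algX indX.
  have [Z [algZ ZX indZ minZ]] := minimal_algebraic algX indX.
  exists (fun=> Z); split; last by rewrite Ik.
  by move=> i _; split=> //; exact: minimal_indep_irreducible minZ.
have [Z [algZ ZX indZ minZ]] := minimal_algebraic algX indX.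
have /card_gt0P[i iI] : (0 < #|I|)%N by rewrite Ik.
have [a [a0 indS]] := indep_slice algZ indZ iI.
have Ik' : #|I :\ i| = k by move: Ik; rewrite (cardsD1 i) iI add1n => -[].
have [W [Wirr Wstrict]] := IH _ _ Ik' (algebraic_slice i a0 algZ) indS.
rewrite Ik' in Wirr Wstrict.
exists (fun j => if (j <= k)%N then W j else Z); rewrite Ik; split=> j.
  move=> _; case: ifP => [jk|_].
    have [Wj WS] := Wirr j jk; split=> // z /WS[Zz _]; exact: ZX.
  by split=> //; exact: minimal_indep_irreducible minZ.
rewrite ltnS => jk; rewrite jk; case: ltnP => [kj|kj].
  exact: Wstrict.
have [_ WS] := Wirr j jk.
split; first by move=> z /WS[].
move=> ZW; have : meval (mask I (fun=> a + 1)) (mpolyX K (mnm1 i) - mpolyC n a) = 0.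
  apply: indZ => z /ZW /WS[_ zi].
  by rewrite mevalB mevalXU mevalC /mask iI zi subrr.
rewrite mevalB mevalXU mevalC /mask iI addrC addKr => /eqP.
by rewrite oner_eq0.
Qed.

End Noetherian.

(** * Counting points on a grid *)

Section Counting.
Variables (K : closedFieldType) (n : nat).
Implicit Types (p q r : mpoly n K) (J : {set 'I_n}).
Implicit Types (X : set (Gm K n)) (z : Gm K n).

Lemma interpolation (s : seq (Gm K n)) (z : Gm K n) : z \notin s ->
  exists p, meval z p != 0 /\ forall y, y \in s -> meval y p = 0.
Proof.
move=> zs; have sep y : exists p, y != z -> meval z p != 0 /\ meval y p = 0.
  have [->|yz] := eqVneq y z; first by exists 0.
  have [i yi] : exists i, y i != z i.
    apply/existsP; apply: contraT; rewrite negb_exists => /forallP E.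
    case/eqP: yz; apply/val_inj/ffunP => i.
    by apply/eqP; move: (E i); rewrite negbK.
  exists (mpolyX K (mnm1 i) - mpolyC n (y i)) => _.
  by rewrite !mevalB !mevalXU !mevalC subrr subr_eq0 eq_sym.
have [f fP] := choice sep.
have ne y : y \in s -> y != z by apply: contraTneq => ->.
exists (\prod_(y <- s) f y); split=> [|y ys].
  rewrite rmorph_prod prodf_seq_neq0; apply/allP => y /ne yz /=.
  by have [] := fP y yz.
rewrite rmorph_prod (big_rem y ys) /=.
by have [_ ->] := fP y (ne _ ys); rewrite mul0r.
Qed.

(** The functions on [s] form a space of dimension [size s], which is spanned
by the monomials [phi t]: every other monomial is, on [s], a combination of
smaller ones.  Dually, a linear form on functions that kills the monomials
[phi t] kills all monomials, hence is zero; so the matrix of values of these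
monomials at [s] has independent rows. *)
Lemma footprint_bound (T : finType) (phi : T -> multinom n) (s : seq (Gm K n)) :
    uniq s ->
    (forall m, (forall t, phi t <> m) -> exists r,
      [/\ r != 0, forall z, z \in s -> meval z r = 0 & lem (mlead r) m]) ->
  (size s <= #|T|)%N.
Proof.
move=> us red; pose x (i : 'I_(size s)) := tnth (in_tuple s) i.
pose M := \matrix_(i < size s, j < #|T|) meval (x i) (mpolyX K (phi (enum_val j))).
suff /eqP <- : row_free M by exact: rank_leq_col.
apply: inj_row_free => v vM.
pose L p := \sum_i v 0 i * meval (x i) p.
have LE p : L p = \sum_(m <- msupp p) mcoeff m p * L (mpolyX K m).
  rewrite {1}(mpolyE p) /L.
  under eq_bigr => i _ do rewrite raddf_sum mulr_sumr.
  rewrite exchange_big; apply: eq_bigr => m _; rewrite mulr_sumr.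
  by apply: eq_bigr => i _; rewrite /= mevalZ mulrCA.
have LX m : L (mpolyX K m) = 0.
  apply: (@ltmwf n (fun m => L (mpolyX K m) = 0)) m => m IH.
  have [[t <-]|/forallNP notphi] := pselect (exists t, phi t = m).
    move/rowP/(_ (enum_rank t)): vM; rewrite !mxE => <-.
    by apply: eq_bigr => i _; rewrite mxE enum_rankK.
  have [r [r0 rs rm]] := red m notphi.
  have X0 : mpolyX K m != 0 by rewrite -mleadc_eq0 mleadXm mcoeffX eqxx oner_eq0.
  have rX : lem (mlead r) (mlead (mpolyX K m)) by rewrite mleadXm.
  have [a [c /=]] := mlead_cancel X0 r0 rX.
  set q := _ - _ => q_small.
  have -> : L (mpolyX K m) = L q.
    apply: eq_bigr => i _; rewrite /q mevalB mevalZ mevalM rs ?mem_tnth //.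
    by rewrite !mulr0 subr0.
  case: q_small => [->|]; first by rewrite /L big1 // => i _; rewrite meval0 mulr0.
  rewrite mleadXm LE => qm; apply: big1_seq => k /andP[_ /msupp_le_mlead kq].
  by rewrite IH ?mulr0 //; exact: le_lt_trans qm.
have L0 p : L p = 0 by rewrite LE big1 // => m _; rewrite LX mulr0.
apply/rowP => i; rewrite mxE.
have [|p [pi pz]] := @interpolation (rem (x i) s) (x i).
  by rewrite mem_rem_uniqF.
have := L0 p; rewrite /L (bigD1 i) //= big1 ?addr0.
  by move/eqP; rewrite mulf_eq0 (negbTE pi) orbF => /eqP.
move=> j ji; rewrite pz ?mulr0 // mem_rem_uniq // inE mem_tnth andbT.
have xinj : injective x by exact/tuple_uniqP.
by apply: contraNneq ji => /xinj ->.
Qed.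

Lemma expg_coord z m i : (z ^+ m)%g i = z i ^+ m.
Proof.
elim: m => [|m IH]; first by rewrite expg0 ffunE expr0.
by rewrite expgS ffunE IH exprS.
Qed.

(** A monomial that no leading monomial divides has all exponents below [m],
and at most [e] of them exceed [D], the largest exponent in the leading
monomials of the relations [r J].  It is described by the positions of these
large exponents, their values, and the exponents at the other positions. *)
Lemma count_expg_eq1 X e : (0 < n)%N ->
    (forall J, #|J| = e.+1 -> ~ indep J X) ->
  exists C, forall m (s : seq (Gm K n)), (0 < m)%N -> uniq s ->
    (forall z, z \in s -> X z /\ (z ^+ m)%g = 1%g) -> (size s <= C * m ^ e)%N.
Proof.
move=> n0 dep.
have rel J : exists r, #|J| = e.+1 -> [/\ r != 0, forall z, X z -> meval z r = 0 &
    forall i, i \notin J -> mlead r i = 0%N].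
  have [Je|] := pselect (#|J| = e.+1); last by exists 0.
  have := dep J Je; rewrite /indep => /existsNP[p /not_implyP[pX /existsNP[v pv]]].
  exists (mask_poly J p) => _; split=> [|z Xz|i].
  - apply/eqP => E; apply: pv.
    by rewrite -meval_mask_poly E meval0.
  - by rewrite meval_mask_poly pX.
  - exact: mlead_mask_poly.
have [r rP] := choice rel.
pose D := (\max_(J : {set 'I_n}) \max_(i < n) mlead (r J) i)%N.
have rD J i : (mlead (r J) i <= D)%N.
  apply: leq_trans (leq_bigmax J).
  exact: (leq_bigmax (F := fun i => mlead (r J) i)).
exists (n ^ e * D.+1 ^ n)%N => -[//|m] s _ us sX.
(* [t : T] lists [e] positions covering those of the large exponents, the
   small exponents, and the exponents at the listed positions *)
pose T := ({ffun 'I_e -> 'I_n} * {ffun 'I_n -> 'I_D.+1} * {ffun 'I_e -> 'I_m.+1})%type.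
have -> : (n ^ e * D.+1 ^ n * m.+1 ^ e)%N = #|{: T}|.
  by rewrite !card_prod !card_ffun !card_ord.
pose phi (t : T) := Multinom [tuple
  if [pick l | t.1.1 l == i] is Some l then t.2 l : nat else t.1.2 i | i < n].
apply: (@footprint_bound _ phi) => // mu notphi.
have [/existsP[i mi]|small] := boolP [exists i, (m < mu i)%N].
  pose rt : mpoly n K := mpolyX K (mnm_muln (mnm1 i) m.+1) - 1.
  have lrt : mlead rt = mnm_muln (mnm1 i) m.+1.
    rewrite /rt mleadDl mleadXm // mleadN mlead1 lt_neqAle le0m andbT.
    by apply/eqP => /mnmP/(_ i); rewrite mnm0E mulmnE mnm1E eqxx.
  exists rt; rewrite lrt; split.
  - apply/eqP => E; move: lrt; rewrite E mlead0 => /mnmP/(_ i).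
    by rewrite mnm0E mulmnE mnm1E eqxx.
  - move=> z /sX[_ zm]; rewrite /rt -mpolyXn mevalB meval1 rmorphXn /= mevalXU.
    by rewrite -expg_coord zm ffunE subrr.
  - apply/mnm_lepP => j; rewrite mulmnE mnm1E; case: eqP => [<-|] //.
    by rewrite mul1n.
have {}small i : (mu i < m.+1)%N.
  by move: small; rewrite negb_exists => /forallP/(_ i); rewrite -leqNgt.
pose H := [set i | D < mu i]%N.
have [/card_geqP[q [uq qe qH]]|He] := leqP e.+1 #|H|.
  pose J := [set i in q].
  have [|r0 rX rJ] := rP J.
    by rewrite cardsE (card_uniqP uq).
  exists (r J); split=> // [z /sX[Xz _]|]; first exact: rX.
  apply/mnm_lepP => i; have [iJ|/rJ->//] := boolP (i \in J).
  have : i \in H by apply: qH; rewrite inE in iJ.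
  by rewrite inE => /ltnW; apply: leq_trans.
pose i0 := Ordinal n0.
pose t1 : {ffun 'I_e -> 'I_n} := [ffun l : 'I_e => nth i0 (enum H) l].
pose t : T := (t1, [ffun i => inord (mu i)], [ffun l => inord (mu (t1 l))]).
case: (notphi t); apply/mnmP => i; rewrite mnmE /=.
case: pickP => [l /eqP li|noti]; first by rewrite ffunE li inordK.
rewrite ffunE inordK // ltnS leqNgt; apply/negP => iH.
have iE : i \in enum H by rewrite mem_enum inE.
have il : (index i (enum H) < e)%N.
  by rewrite -ltnS (leq_trans _ He) // ltnS cardE index_mem.
by have := noti (Ordinal il); rewrite ffunE /= nth_index // eqxx.
Qed.

End Counting.

(** * Summing over the orders *)

Lemma ord_spec (G : groupType) (x : G) : is_torsion x ->
  (0 < ord x)%N /\ (x ^+ ord x)%g = 1%g.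
Proof.
move=> tx; rewrite /ord; case: pselect => // tx'.
by case: ex_minnP => m /andP[m0 /eqP xm] _.
Qed.

Lemma size_le_sum_count (T : Type) (f : T -> nat) (N b : nat) (s : seq T) :
    all (fun x => 0 < f x <= N)%N s ->
    (forall m, (0 < m <= N)%N -> (count (fun x => f x == m) s <= b)%N) ->
  (size s <= N * b)%N.
Proof.
move=> sN sb; apply: (@leq_trans (\sum_(m < N) count (fun x => f x == m.+1) s)).
  elim: s sN {sb} => [|x s IH] //= /andP[/andP[x0 xN] /IH {}IH].
  rewrite big_split /= -add1n leq_add //.
  have xN' : ((f x).-1 < N)%N by rewrite prednK.
  by rewrite (bigD1 (Ordinal xN')) //= prednK // eqxx.
rewrite -[N in (_ <= N * _)%N]card_ord -sum_nat_const.
by apply: leq_sum => m _; apply: sb; rewrite /= ltn_ord.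
Qed.

Lemma card_fset_set_le (T : choiceType) (A : set T) (N : nat) :
    (forall s : seq T, uniq s -> (forall x, x \in s -> A x) -> (size s <= N)%N) ->
  finite_set A /\ (#|` fset_set A|%fset <= N)%N.
Proof.
move=> AN; have finA : finite_set A.
  apply: contrapT => infA.
  have [B BA NB] := infinite_set_fset N.+1 infA.
  by have := AN B (fset_uniq B) (fun x xB => BA x xB); rewrite leqNgt NB.
split=> //; apply: AN => [|x]; first exact: fset_uniq.
by rewrite in_fset_set // inE.
Qed.

Theorem proposition1p3 (R : realType) (K : closedFieldType) (n : nat)
    (hn : (1 <= n)%N) (X : set (Gm K n)) (d : int)
    (algX : algebraic X) (dimX : has_dim X d) :
  exists c : R, 0 < c /\
    forall T : R, 1 <= T ->
      finite_set (torsion_le X T) /\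
      (#|` fset_set (torsion_le X T)|%fset)%:R <= c * T ^ (d + 1).
Proof.
have [X0|/set0P[x0 Xx0]] := eqVneq X set0.
  exists 1; split=> // T T1.
  have -> : torsion_le X T = set0.
    by apply/seteqP; split=> z // [+ _ _]; rewrite X0.
  split=> //; rewrite fset_set0 cardfs0 mul1r.
  by rewrite exprz_ge0 // (le_trans ler01).
have ind0 : `[< indep finset.set0 X >].
  apply/asboolP => p pX v; rewrite -(pX x0 Xx0).
  by apply: meval_eq => i; rewrite /mask inE.
have [J /asboolP indJ Jmax] := @arg_maxnP
  {set 'I_n} _ (fun J => `[< indep J X >]) (fun J => #|J|) ind0.
have Jd := dimX.1 _ (indep_has_chain algX indJ).
have [|C Ctors] := @count_expg_eq1 K n X #|J| hn.
  by move=> I IJ indI; have := Jmax I (asboolT indI); rewrite /= IJ ltnn.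
exists C.+1%:R; split=> // T T1.
have T0 : 0 <= T by apply: le_trans T1.
have [fin card] : finite_set (torsion_le X T) /\
    (#|` fset_set (torsion_le X T)|%fset <=
      Num.truncn T * (C * Num.truncn T ^ #|J|))%N.
  apply: card_fset_set_le => s us sT.
  apply: (@size_le_sum_count _ (@ord _)).
    apply/allP => z /sT[_ /ord_spec[-> _] zT] /=.
    by rewrite truncn_ge_nat.
  move=> m /andP[m0 mT]; rewrite -size_filter.
  apply: leq_trans (Ctors m _ m0 (filter_uniq _ us) _) _; last first.
    by rewrite leq_mul2l; case: #|J| => [|k]; rewrite ?expn0 ?leq_exp2r ?mT ?orbT.
  move=> z; rewrite mem_filter => /andP[/eqP <- /sT[Xz /ord_spec[_ zt] _]].
  by split.
split=> //.
have [k dk] : exists k, d + 1 = k%:Z /\ (#|J| < k)%N.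
  case: d Jd {dimX} => // d Jd; exists d.+1; split; last by rewrite ltnS -lez_nat.
  by rewrite -addn1 PoszD.
rewrite dk.1 -exprnP.
apply: (@le_trans _ _ (Num.truncn T * (C * Num.truncn T ^ #|J|))%N%:R).
  by rewrite ler_nat.
rewrite mulnCA -expnS natrM natrX ler_pM // ?ler_nat ?exprn_ge0 //.
apply: (@le_trans _ _ (T ^+ #|J|.+1)); last exact: ler_weXn2l dk.2.
by rewrite lerXn2r ?nnegrE // truncn_le.
Qed.
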